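(* Let $\Bbbk$ be a commutative ring. Let $j:DD\to B^0_{2,2}$ be the canonical morphism of dendriform dialgebras, i.e. the unique morphism of dendriform dialgebras from the free dendriform dialgebra $DD$ on one generator sending the generator $\mathsf Y$ (the undecorated binary tree with a root and two leaves) to $Y$. Then $j$ sends any rooted planar binary tree $x$ to itself with root label $0$ (i.e. to the tree in $\mathcal T_{2,2}$ with underlying tree $x$, root label $0$, all other internal nodes labeled $1$, and all angles labeled $1$). In particular, $j$ is injective.
   Context: All algebras are associative $\Bbbk$-algebras, not necessarily unital. \textbf{Dendriform dialgebras.} A dendriform dialgebra is a $\Bbbk$-module $D$ with two bilinear operations $\prec,\succ$ such that, with $x\ast y=x\prec y+x\succ y$, for all $x,y,z$: $(x\prec y)\prec z=x\prec(y\ast z)$, $(x\succ y)\prec z=x\succ(y\prec z)$, $(x\ast y)\succ z=x\succ(y\succ z)$. Morphisms are linear maps preserving both operations. If $(A,\beta)$ is a Baxter algebra of weight $0$ (i.e. $\beta$ is linear and $\beta(a)\beta(b)=\beta(\beta(a)b+a\beta(b))$), then $A$ is a dendriform dialgebra via $x\succ y=\beta(x)y$, $x\prec y=x\beta(y)$. \textbf{$DD$.} $DD$ is the free $\Bbbk$-module on the set of finite rooted planar binary trees (every internal node has exactly two children) with at least one internal node; $\bullet$ is the one-node tree. For such $x$ let $x_1,x_2$ be its left and right subtrees, and let $\Gamma(x_1,x_2)$ be the tree obtained by joining $x_1,x_2$ to a new root (extended bilinearly). Operations are defined recursively by $x\ast\bullet=\bullet\ast x=x$, $x\prec y=\Gamma(x_1,x_2\ast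 y)$, $x\succ y=\Gamma(x\ast y_1,y_2)$, $x\ast y=x\prec y+x\succ y$. Then $DD$ is the free dendriform dialgebra on the generator $\mathsf Y$ (Loday). \textbf{Decorated trees.} An angle of a rooted planar tree is the sector between two consecutive children of an internal node. $\mathcal T_{2,2}$ is the set of finite rooted planar trees with at least one internal node, with every angle labeled $1$ and each internal node labeled by $0$ or $1$, such that: every internal node has at least two children; among the children of each node only the leftmost and rightmost can be leaves; only the root may have label $0$. $\mathcal T^+_{2,2}$ (resp. $\mathcal T^0_{2,2}$) is the subset of trees with root label $1$ (resp. $0$); $\widehat{\mathcal T}_{2,2}=\mathcal T_{2,2}\cup\{\bullet\}$, $\widehat{\mathcal T}^+_{2,2}=\mathcal T^+_{2,2}\cup\{\bullet\}$. $Y$ is the tree in $\mathcal T^0_{2,2}$ with a single internal node (the root) having two children, both leaves. \textbf{The Baxter algebra $B^0_{2,2}$ (weight $\lambda=0$).} Since all angle labels are $1$ they are suppressed. Grafting $G:\bigcup_{n\ge1}(\widehat{\mathcal T}^+_{2,2})^n\to\widehat{\mathcal T}_{2,2}$: $G(t)=t$ for $n=1$; for $n\ge2$, $G(t_1,\dots,t_n)$ attaches $t_1,\dots,t_n$ as the subtrees at the children of a new root labeled $0$, and then for each $1<k<n$ with $t_k=\bullet$ removes that leaf and its edge (merging the two adjacent angles). De-grafting: for $t\in\mathcal T^0_{2,2}$, $H(t)=(t_1,\dots,t_n)$ lists the subtrees at the children of the root, left to right; for $t\in\mathcal T^+_{2,2}$, $H(t)=t$ ($n=1$). $B_{2,2}$,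 $\widehat B_{2,2}$ are the free $\Bbbk$-modules on $\mathcal T_{2,2}$, $\widehat{\mathcal T}_{2,2}$; all maps are extended (multi)linearly. $\beta_{2,2}(t)$ is $t$ with root label changed to $1$ if $t\in\mathcal T^0_{2,2}$, and $\beta_{2,2}(t)=0$ if $t\in\mathcal T^+_{2,2}$; $\beta_{2,2}(\bullet)=\bullet$. For $t\in\mathcal T^+_{2,2}$, $\overline t$ is $t$ with root label changed to $0$; $\overline\bullet=\bullet$. Products $\ast$ on $\widehat B_{2,2}$ and $\diamond$ on $B_{2,2}$ are defined by mutual recursion: $\bullet\ast u=u\ast\bullet=u$; for $t,s\in\mathcal T_{2,2}$ with $H(t)=(t_1,\dots,t_n)$, $H(s)=(s_1,\dots,s_m)$, $t\diamond s=G(t_1,\dots,t_{n-1},\beta_{2,2}(\overline t_n\ast\overline s_1),s_2,\dots,s_m)$; and for $u,v\in\mathcal T_{2,2}$, $u\ast v=\beta_{2,2}(u)\diamond v+u\diamond\beta_{2,2}(v)$. $B^0_{2,2}$ is $B_{2,2}$ with product $\diamond$; $(B^0_{2,2},\beta_{2,2})$ is a Baxter algebra of weight $0$ (the free one on an idempotent generator $Y$ with $\beta^2=0$), regarded as a dendriform dialgebra via $u\succ v=\beta_{2,2}(u)\diamond v$, $u\prec v=u\diamond\beta_{2,2}(v)$. *)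

(* Defs.v *)
From HB Require Import structures.
From mathcomp Require Import all_boot ssralg finmap monalg.
From mathcomp Require Import zify.

Set Implicit Arguments.
Unset Strict Implicit.
Unset Printing Implicit Defensive.

Import GRing.Theory.
Local Open Scope ring_scope.

(* Locked: conversion must not compute with linear combinations. *)
HB.lock Definition linext (R : comNzRingType) (K : choiceType) (M : lmodType R)
    (f : K -> M) (u : {malg R[K]}) : M :=
  \sum_(k <- msupp u) u@_k *: f k.
Canonical linext_unlockable := Unlockable linext.unlock.

Section LinearExtension.
Context (R : comNzRingType) (K : choiceType) (M : lmodType R).

Lemma linextE (f : K -> M) (u : {malg R[K]}) :
  linext f u = \sum_(k <- msupp u) u@_k *: f k.
Proof. by rewrite unlock. Qed.

Lemma linextEw (f : K -> M) (u : {malg R[K]}) (d : {fset K}) :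
  (msupp u `<=` d)%fset -> linext f u = \sum_(k <- d) u@_k *: f k.
Proof.
move=> ud; rewrite linextE; apply: big_fset_incl => // k _ /mcoeff_outdom ->.
by rewrite scale0r.
Qed.

Lemma linext_is_linear (f : K -> M) : linear (linext f).
Proof.
move=> a u v; pose d := (msupp u `|` msupp v)%fset.
have dl : (msupp (a *: u + v) `<=` d)%fset.
  apply: fsubset_trans (msuppD_le _ _) _.
  by apply: fsetUSS; [exact: msuppZ_le | exact: fsubset_refl].
rewrite (linextEw _ dl) (linextEw f (fsubsetUl _ _ : (msupp u `<=` d)%fset)).
rewrite (linextEw f (fsubsetUr _ _ : (msupp v `<=` d)%fset)).
rewrite scaler_sumr -big_split /=; apply: eq_bigr => k _.
by rewrite mcoeffD mcoeffZ scalerDl scalerA.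
Qed.

HB.instance Definition _ (f : K -> M) :=
  GRing.isLinear.Build R {malg R[K]} M *:%R (linext f) (linext_is_linear f).

Lemma linextU (f : K -> M) (k : K) : linext f << k >> = f k.
Proof.
by rewrite linextE msuppU oner_eq0 big_seq_fset1 mcoeffUU scale1r.
Qed.

Lemma eq_linext (f g : K -> M) : f =1 g -> linext f =1 linext g.
Proof. by move=> fg u; rewrite !linextE; apply: eq_bigr => k _; rewrite fg. Qed.

End LinearExtension.

Definition bilext (R : comNzRingType) (K L : choiceType) (M : lmodType R)
    (f : K -> L -> M) (u : {malg R[K]}) (v : {malg R[L]}) : M :=
  linext (fun k => linext (f k) v) u.

Lemma bilextU (R : comNzRingType) (K L : choiceType) (M : lmodType R)
    (f : K -> L -> M) (k : K) (l : L) : bilext f << k >> << l >> = f k l.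
Proof. by rewrite /bilext !linextU. Qed.

(* [p] and [s] stand for the operations "prec" and "succ" of a dendriform
   dialgebra. *)

Definition dendriform_morphism (R : comNzRingType) (D E : lmodType R)
    (pD sD : D -> D -> D) (pE sE : E -> E -> E) (f : {linear D -> E}) : Prop :=
  (forall x y, f (pD x y) = pE (f x) (f y)) /\
  (forall x y, f (sD x y) = sE (f x) (f y)).

(* Includes the one-node tree [BLeaf], which is excluded from [PBT]. *)
Inductive btree : Type := BLeaf | BNode of btree & btree.

Fixpoint btree_encode (x : btree) : GenTree.tree unit :=
  if x is BNode a b then GenTree.Node 0 [:: btree_encode a; btree_encode b]
  else GenTree.Leaf tt.

Fixpoint btree_decode (t : GenTree.tree unit) : option btree :=
  match t with
  | GenTree.Leaf _ => Some BLeaf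
  | GenTree.Node _ [:: a; b] =>
      if (btree_decode a, btree_decode b) is (Some x, Some y)
      then Some (BNode x y) else None
  | _ => None
  end.

Lemma btree_encodeK : pcancel btree_encode btree_decode.
Proof. by elim=> //= a -> b ->. Qed.

HB.instance Definition _ := Equality.copy btree (pcan_type btree_encodeK).
HB.instance Definition _ := Choice.copy btree (pcan_type btree_encodeK).

Definition is_bnode (x : btree) : bool := if x is BNode _ _ then true else false.
Definition left_subtree (x : btree) := if x is BNode a _ then a else BLeaf.
Definition right_subtree (x : btree) := if x is BNode _ b then b else BLeaf.

Record PBT := MkPBT { btree_of :> btree; _ : is_bnode btree_of }.
HB.instance Definition _ := [isSub for btree_of].
HB.instance Definition _ := [Choice of PBT by <:].

Definition bjoin (a b : btree) : PBT := @MkPBT (BNode a b) isT.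

Definition Ygen : PBT := bjoin BLeaf BLeaf.

(* [hatDD] is the span of DD and of the one-node tree. *)
Notation DD R := {malg R[PBT]}.
Notation hatDD R := {malg R[btree]}.

Section DD.
Context (R : comNzRingType).
Local Notation DD := (DD R).
Local Notation hatDD := (hatDD R).

Definition DD_incl : DD -> hatDD := linext (fun x : PBT => << btree_of x >>).

Definition Gamma : hatDD -> hatDD -> DD :=
  bilext (fun a b => << bjoin a b >>).

(* Lexicographic recursion: the first summand recurses on the right subtree
   of x, the second one on the left subtree of y. *)
Fixpoint btree_star (x : btree) : btree -> hatDD :=
  fix btree_star_x (y : btree) : hatDD :=
    match x, y with
    | BLeaf, _ => << y >>
    | _, BLeaf => << x >>
    | BNode x1 x2, BNode y1 y2 =>
        DD_incl (Gamma << x1 >> (btree_star x2 y)) +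
        DD_incl (Gamma (btree_star_x y1) << y2 >>)
    end.

Definition DD_prec : DD -> DD -> DD := bilext (fun x y : PBT =>
  Gamma << left_subtree x >> (btree_star (right_subtree x) y)).

Definition DD_succ : DD -> DD -> DD := bilext (fun x y : PBT =>
  Gamma (btree_star x (left_subtree y)) << right_subtree y >>).

Lemma btree_star_leafl (y : btree) : btree_star BLeaf y = << y >>.
Proof. by case: y. Qed.

Lemma btree_star_leafr (x : btree) : btree_star x BLeaf = << x >>.
Proof. by case: x. Qed.

Lemma btree_starE (x y : PBT) :
  btree_star x y = DD_incl (DD_prec << x >> << y >> + DD_succ << x >> << y >>).
Proof.
rewrite /DD_prec /DD_succ !bilextU /DD_incl linearD.
by case: x => [[|x1 x2] // ?]; case: y => [[|y1 y2] // ?].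
Qed.

End DD.

(* An internal node with label [i] and children [c], from left to right, is
   [GenTree.Node i c]. All the angle labels are 1, hence not represented. *)

Definition ptree : Type := GenTree.tree unit.
HB.instance Definition _ := Choice.on ptree.

Definition pleaf : ptree := GenTree.Leaf tt.
Notation pnode i c := (GenTree.Node i c : ptree).

Definition is_pleaf (t : ptree) : bool :=
  if t is GenTree.Leaf _ then true else false.

(* All but the last item, resp. all but the first and the last ones. *)
Definition front (c : seq ptree) : seq ptree := take (size c).-1 c.
Definition middle (c : seq ptree) : seq ptree := behead (front c).

Fixpoint good_shape (t : ptree) : bool :=
  if t is GenTree.Node _ c then
    [&& 2 <= size c, all (fun s => ~~ is_pleaf s) (middle c)
      & all good_shape c]%N
  else true.

Fixpoint all_labels1 (t : ptree) : bool :=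
  if t is GenTree.Node i c then (i == 1)%N && all all_labels1 c else true.

Definition in_T22 (t : ptree) : bool :=
  if t is GenTree.Node i c then
    [&& (i == 0)%N || (i == 1)%N, all all_labels1 c & good_shape t]
  else false.

Record T22 := MkT22 { ptree_of :> ptree; _ : in_T22 ptree_of }.
HB.instance Definition _ := [isSub for ptree_of].
HB.instance Definition _ := [Choice of T22 by <:].

Definition Ytree : T22 := @MkT22 (pnode 0 [:: pleaf; pleaf]) isT.

(* The map G; it is only used on nonempty sequences. *)
Definition graft (ts : seq ptree) : ptree :=
  if size ts == 1%N then head pleaf ts
  else pnode 0 (head pleaf ts ::
                rcons [seq s <- middle ts | ~~ is_pleaf s] (last pleaf ts)).

(* The map H. *)
Definition degraft (t : ptree) : seq ptree :=
  if t is GenTree.Node 0 c then c else [:: t].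

(* The root label is changed to 0; this is only used on trees in T^+ and on the
   one-node tree. *)
Definition overline (t : ptree) : ptree :=
  if t is GenTree.Node _ c then pnode 0 c else t.

Fixpoint nb_nodes (t : ptree) : nat :=
  if t is GenTree.Node _ c then (sumn (map nb_nodes c)).+1 else 0.

(* The maps beta, * and <> are first computed in the free module on all the
   decorated trees, and then restricted to the free module on [T22]. The
   restriction loses nothing by [B22_betaE] and [B22_diamondE], and [pstarE]
   is the recursive definition of *. *)

Section ProductRec.
Context (R : comNzRingType).

Definition pbeta (t : ptree) : {malg R[ptree]} :=
  match t with
  | GenTree.Leaf _ => << t >>
  | GenTree.Node 0 c => << pnode 1 c >>
  | GenTree.Node _ _ => 0
  end.

(* The linear extension to w of
     w |-> G (t_1, ..., t_{n-1}, beta w, s_2, ..., s_m)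
   where H t = (t_1, ..., t_n) and H s = (s_1, ..., s_m). *)
Definition diamond_with (t s : ptree) (w : {malg R[ptree]}) : {malg R[ptree]} :=
  linext (fun x => << graft (front (degraft t) ++ x :: behead (degraft s)) >>)
    (linext pbeta w).

Definition overline_last (t : ptree) := overline (last pleaf (degraft t)).
Definition overline_first (s : ptree) := overline (head pleaf (degraft s)).

(* The mutual recursion between * and <> is bounded by [n]; [pstarE] shows that
   the bound chosen in [pstar] is never reached. *)
Fixpoint pstar_rec (n : nat) (u v : ptree) : {malg R[ptree]} :=
  if n is n'.+1 then
    let diamond t s := diamond_with t s
      (pstar_rec n' (overline_last t) (overline_first s)) in
    if is_pleaf u then << v >> else if is_pleaf v then << u >> else
    linext (fun u' => diamond u' v) (pbeta u) + linext (diamond u) (pbeta v)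
  else 0.

End ProductRec.

HB.lock Definition pstar (R : comNzRingType) (u v : ptree) : {malg R[ptree]} :=
  pstar_rec R (nb_nodes u + nb_nodes v).+3 u v.
Canonical pstar_unlockable := Unlockable pstar.unlock.

Section Products.
Context (R : comNzRingType).
Local Notation pbeta := (pbeta R).
Local Notation pstar_rec := (pstar_rec R).
Local Notation pstar := (pstar R).

Definition pdiamond (t s : ptree) : {malg R[ptree]} :=
  diamond_with t s (pstar (overline_last t) (overline_first s)).

Lemma nb_overline (t : ptree) : nb_nodes (overline t) = nb_nodes t.
Proof. by case: t. Qed.

Lemma nb_head_lt (i : nat) (c : seq ptree) :
  (nb_nodes (head pleaf c) < nb_nodes (pnode i c))%N.
Proof. by case: c => //= t c; rewrite ltnS leq_addr. Qed.

Lemma nb_last_lt (i : nat) (c : seq ptree) :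
  (nb_nodes (last pleaf c) < nb_nodes (pnode i c))%N.
Proof.
case/lastP: c => // c t.
by rewrite last_rcons /= map_rcons sumn_rcons ltnS leq_addl.
Qed.

Lemma pbeta0E (c : seq ptree) : pbeta (pnode 0 c) = << pnode 1 c >>.
Proof. by []. Qed.

Lemma pbeta1E (i : nat) (c : seq ptree) : pbeta (pnode i.+1 c) = 0.
Proof. by []. Qed.

Lemma linext0 (f : ptree -> {malg R[ptree]}) : linext f 0 = 0.
Proof. exact: linear0. Qed.

Lemma pstar_recE (n i j : nat) (c d : seq ptree) :
  let diamond t s := diamond_with t s
    (pstar_rec n (overline_last t) (overline_first s)) in
  pstar_rec n.+1 (pnode i c) (pnode j d) =
  linext (fun u' => diamond u' (pnode j d)) (pbeta (pnode i c)) +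
  linext (diamond (pnode i c)) (pbeta (pnode j d)).
Proof. by []. Qed.

Definition weight (t : ptree) : nat :=
  nb_nodes t + (if t is GenTree.Node i _ then i != 0%N : nat else 0%N).

Lemma weight_overline_first (i : nat) (c : seq ptree) :
  (weight (overline_first (pnode i c)) + (i == 0%N) <=
   nb_nodes (pnode i c))%N.
Proof.
case: i => [|i]; rewrite /overline_first /weight nb_overline.
  have := nb_head_lt 0 c; rewrite /degraft.
  by case: (head _ _) => [x|i d] /= h; rewrite ?addn0 addn1.
by rewrite /= !addn0.
Qed.

Lemma weight_overline_last (i : nat) (c : seq ptree) :
  (weight (overline_last (pnode i c)) + (i == 0%N) <=
   nb_nodes (pnode i c))%N.
Proof.
case: i => [|i]; rewrite /overline_last /weight nb_overline.
  have := nb_last_lt 0 c; rewrite /degraft.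
  by case: (last _ _) => [x|i d] /= h; rewrite ?addn0 addn1.
by rewrite /= !addn0.
Qed.

Lemma weight_diamondl (i : nat) (c d : seq ptree) :
  (weight (overline_last (pnode 1 c)) + weight (overline_first (pnode i d)) <
   weight (pnode 0 c) + weight (pnode i d))%N.
Proof.
have := weight_overline_last 1 c; have := weight_overline_first i d.
rewrite /weight /=; case: i => [|i] /=; lia.
Qed.

Lemma weight_diamondr (i : nat) (c d : seq ptree) :
  (weight (overline_last (pnode i c)) + weight (overline_first (pnode 1 d)) <
   weight (pnode i c) + weight (pnode 0 d))%N.
Proof.
have := weight_overline_last i c; have := weight_overline_first 1 d.
rewrite /weight /=; case: i => [|i] /=; lia.
Qed.

Lemma weight_le (t : ptree) : (weight t <= (nb_nodes t).+1)%N.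
Proof. by case: t => [x|[|i] c]; rewrite /weight /=; lia. Qed.

Lemma pstar_rec_stable (n m : nat) (u v : ptree) :
  (weight u + weight v < n)%N -> (weight u + weight v < m)%N ->
  pstar_rec n u v = pstar_rec m u v.
Proof.
elim: n m u v => [|n IHn] m u v; first by rewrite ltn0.
case: m => [|m]; first by rewrite ltn0.
case: u => [x|i c]; first by [].
case: v => [x|j d]; first by [].
move=> /ltnSE nu /ltnSE mu.
rewrite (pstar_recE n) (pstar_recE m); apply: (f_equal2 +%R).
  case: i nu mu => [|i] nu mu; last by rewrite pbeta1E !linext0.
  rewrite pbeta0E !linextU; rewrite (IHn m) //.
    exact: leq_trans (weight_diamondl _ _ _) nu.
  exact: leq_trans (weight_diamondl _ _ _) mu.
case: j nu mu => [|j] nu mu; last by rewrite pbeta1E !linext0.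
rewrite pbeta0E !linextU; rewrite (IHn m) //.
  exact: leq_trans (weight_diamondr _ _ _) nu.
exact: leq_trans (weight_diamondr _ _ _) mu.
Qed.

Lemma pstar_leafl (v : ptree) : pstar pleaf v = << v >>.
Proof. by rewrite unlock. Qed.

Lemma pstar_leafr (u : ptree) : pstar u pleaf = << u >>.
Proof. by rewrite unlock; case: u => [[]|i c]. Qed.

Lemma pstar_recP (n : nat) (u v : ptree) :
  (weight u + weight v < n)%N -> pstar_rec n u v = pstar u v.
Proof.
move=> un; rewrite pstar.unlock; apply: pstar_rec_stable un _.
by have := weight_le u; have := weight_le v; lia.
Qed.

Lemma pstarE (u v : ptree) : ~~ is_pleaf u -> ~~ is_pleaf v ->
  pstar u v = linext (fun u' => pdiamond u' v) (pbeta u) +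
              linext (pdiamond u) (pbeta v).
Proof.
case: u => [x|i c]; first by [].
case: v => [x|j d]; first by [].
move=> _ _; rewrite -(@pstar_recP (weight (pnode i c) + weight (pnode j d)).+1) //.
rewrite pstar_recE; apply: (f_equal2 +%R).
  case: i => [|i]; last by rewrite pbeta1E !linext0.
  by rewrite pbeta0E !linextU pstar_recP // weight_diamondl.
case: j => [|j]; last by rewrite pbeta1E !linext0.
by rewrite pbeta0E !linextU pstar_recP // weight_diamondr.
Qed.

Definition in_T22plus_hat (t : ptree) : bool := good_shape t && all_labels1 t.

Definition supported (P : pred ptree) (u : {malg R[ptree]}) : Prop :=
  {in msupp u, forall t, P t}.

Lemma supportedU (P : pred ptree) (t : ptree) : P t -> supported P << t >>.
Proof. by move=> Pt k; rewrite msuppU oner_eq0 inE => /eqP ->. Qed.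

Lemma supported0 (P : pred ptree) : supported P 0.
Proof. by move=> k; rewrite msupp0. Qed.

Lemma supportedD (P : pred ptree) (u v : {malg R[ptree]}) :
  supported P u -> supported P v -> supported P (u + v).
Proof.
move=> Pu Pv k /(fsubsetP (msuppD_le _ _)).
by rewrite inE => /orP[/Pu | /Pv].
Qed.

Lemma supportedZ (P : pred ptree) (a : R) (u : {malg R[ptree]}) :
  supported P u -> supported P (a *: u).
Proof. by move=> Pu k /(fsubsetP (msuppZ_le _ _)) /Pu. Qed.

Lemma supported_linext (P Q : pred ptree) (f : ptree -> {malg R[ptree]})
    (u : {malg R[ptree]}) :
  supported Q u -> (forall t, Q t -> supported P (f t)) ->
  supported P (linext f u).
Proof.
move=> Qu Pf; rewrite linextE big_seq.
apply: (big_ind (supported P)) => [|v w|t /Qu /Pf]; first exact: supported0.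
  exact: supportedD.
exact: supportedZ.
Qed.

Lemma in_T22_nonleaf (t : ptree) : in_T22 t -> ~~ is_pleaf t.
Proof. by case: t. Qed.

Lemma in_T22_hat (t : ptree) :
  in_T22plus_hat t -> ~~ is_pleaf t -> in_T22 t.
Proof.
case: t => // i c /andP[gs /andP[i1 l1]] _.
by rewrite /in_T22 i1 orbT l1.
Qed.

Lemma pbeta_T22 (t : ptree) : in_T22 t ->
  supported (fun x => in_T22plus_hat x && ~~ is_pleaf x) (pbeta t).
Proof.
case: t => // -[|i] c; last by move=> _; exact: supported0.
move=> /and3P[_ l1 gs]; apply: supportedU.
by rewrite /in_T22plus_hat /= l1 !andbT.
Qed.

Lemma in_T22_overline (t : ptree) :
  in_T22plus_hat t -> ~~ is_pleaf t -> in_T22 (overline t).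
Proof. by case: t => // i c /andP[gs /andP[_ l1]] _; rewrite /in_T22 /= l1. Qed.

Lemma degraft_T22 (t : ptree) : in_T22 t ->
  all in_T22plus_hat (degraft t) /\
  ((2 <= size (degraft t))%N \/ degraft t = [:: t] /\ in_T22plus_hat t).
Proof.
case: t => // -[|i] c.
  move=> /and3P[_ l1 /and3P[sc _ gs]]; split; last by left.
  apply/allP=> x xc; apply/andP; split; last exact: (allP l1).
  exact: (allP gs).
move=> /and3P[i1 l1 gs]; have h : in_T22plus_hat (pnode i.+1 c).
  by rewrite /in_T22plus_hat gs /= l1 andbT.
by rewrite /= h; split=> //; right.
Qed.

Lemma middle_rcons (x y : ptree) (c : seq ptree) :
  middle (x :: rcons c y) = c.
Proof.
by rewrite /middle /front /= size_rcons /= -cats1 take_size_cat.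
Qed.

Lemma graft_T22 (ts : seq ptree) :
  all in_T22plus_hat ts -> (2 <= size ts)%N -> in_T22 (graft ts).
Proof.
case: ts => // x ts; case/lastP: ts => // ts y.
rewrite /graft /= size_rcons /= middle_rcons last_rcons.
rewrite all_rcons => /and3P[/andP[gx lx] /andP[gy ly] al] _.
set f := filter _ _.
have fs : subseq f ts by exact: filter_subseq.
have gl : all good_shape f /\ all all_labels1 f.
  split; apply/allP=> z /(mem_subseq fs) /(allP al) /andP[] //.
rewrite /in_T22 [good_shape _]/= -/good_shape middle_rcons /=.
by rewrite !all_rcons size_rcons gx lx gy ly gl.1 gl.2 filter_all.
Qed.

Let star_supp (u v t : ptree) : bool :=
  in_T22 t || [&& is_pleaf u, is_pleaf v & is_pleaf t].

Lemma diamond_with_T22 (t s : ptree) (w : {malg R[ptree]}) :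
  in_T22 t -> in_T22 s ->
  supported (star_supp (overline_last t) (overline_first s)) w ->
  supported in_T22 (diamond_with t s w).
Proof.
move=> tT sT sw; have [tH tS] := degraft_T22 tT; have [sH sS] := degraft_T22 sT.
pose Q x := in_T22plus_hat x && (is_pleaf x ==>
  is_pleaf (overline_last t) && is_pleaf (overline_first s)).
have Qw : supported Q (linext pbeta w).
  apply: supported_linext sw _ => x /orP[/pbeta_T22 xT | /and3P[p1 p2 p3]].
    by move=> k /xT /andP[kH kl]; rewrite /Q kH (negbTE kl).
  case: x p3 => // x _; apply: supportedU.
  by rewrite /Q p1 p2.
apply: supported_linext Qw _ => x /andP[xH xl]; apply: supportedU.
have al : all in_T22plus_hat
    (front (degraft t) ++ x :: behead (degraft s)).
  rewrite all_cat /= xH /=; apply/andP; split; apply/allP => y.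
    by move/mem_take/(allP tH).
  by move/mem_behead/(allP sH).
have [t2|[t1 t1H]] := tS.
  apply: graft_T22 al _; rewrite size_cat size_takel ?leq_pred //=; lia.
have [s2|[s1 s1H]] := sS.
  by apply: graft_T22 al _; rewrite size_cat /= size_behead; lia.
rewrite t1 s1 /front /= /graft /=; apply: in_T22_hat xH _.
apply: contraL xl => ->; rewrite /= negb_and /overline_last t1 /=.
by case: (t) tT.
Qed.

Lemma overline_T22 (t : ptree) : in_T22plus_hat t ->
  in_T22 (overline t) || is_pleaf (overline t).
Proof.
move=> tH; have [|tl] := boolP (is_pleaf t); first by case: t tH => //= *; rewrite orbT.
by rewrite in_T22_overline.
Qed.

Lemma overline_last_T22 (t : ptree) : in_T22 t ->
  in_T22 (overline_last t) || is_pleaf (overline_last t).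
Proof.
move=> /degraft_T22[tH _]; apply: overline_T22.
by case/lastP: (degraft t) tH => // c x; rewrite all_rcons last_rcons => /andP[].
Qed.

Lemma overline_first_T22 (t : ptree) : in_T22 t ->
  in_T22 (overline_first t) || is_pleaf (overline_first t).
Proof.
move=> /degraft_T22[tH _]; apply: overline_T22.
by case: (degraft t) tH => // x c /andP[].
Qed.

Lemma pstar_rec_T22 (n : nat) (u v : ptree) :
  in_T22 u || is_pleaf u -> in_T22 v || is_pleaf v ->
  supported (star_supp u v) (pstar_rec n u v).
Proof.
elim: n u v => [|n IHn] u v; first by move=> *; exact: supported0.
case: u => [x|i c] uT.
  move=> vT; apply: supportedU; move: vT; rewrite /star_supp /=.
  by rewrite andbb.
case: v => [x|j d] vT.
  by apply: supportedU; rewrite /star_supp; move: uT; rewrite !orbF => ->.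
have {}uT : in_T22 (pnode i c) by case/orP: uT.
have {}vT : in_T22 (pnode j d) by case/orP: vT.
have sub w : supported in_T22 w ->
    supported (star_supp (pnode i c) (pnode j d)) w.
  by move=> wT k /wT; rewrite /star_supp => ->.
apply: sub; rewrite pstar_recE; apply: supportedD.
  apply: supported_linext (pbeta_T22 uT) _ => x /andP[xH xl].
  have xT := in_T22_hat xH xl; apply: diamond_with_T22 => //.
  by apply: IHn; [exact: overline_last_T22 | exact: overline_first_T22].
apply: supported_linext (pbeta_T22 vT) _ => x /andP[xH xl].
have xT := in_T22_hat xH xl; apply: diamond_with_T22 => //.
by apply: IHn; [exact: overline_last_T22 | exact: overline_first_T22].
Qed.

Lemma pdiamond_T22 (t s : ptree) :
  in_T22 t -> in_T22 s -> supported in_T22 (pdiamond t s).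
Proof.
move=> tT sT; apply: diamond_with_T22 => //; rewrite pstar.unlock; apply: pstar_rec_T22.
  exact: overline_last_T22.
exact: overline_first_T22.
Qed.

End Products.

Notation B22 R := {malg R[T22]}.

Section B22.
Context (R : comNzRingType).
Local Notation B22 := (B22 R).

Definition B22_incl : B22 -> {malg R[ptree]} :=
  linext (fun t : T22 => << ptree_of t >>).

(* The linear projection killing the trees outside T_{2,2}; it is only applied
   to elements of the span of T_{2,2}. *)
Definition B22_restrict : {malg R[ptree]} -> B22 :=
  linext (fun t => if insub t is Some t' then << t' : T22 >> else 0).

Definition B22_beta : B22 -> B22 :=
  linext (fun t : T22 => B22_restrict (pbeta R t)).

Definition B22_diamond : B22 -> B22 -> B22 :=
  bilext (fun t s : T22 => B22_restrict (pdiamond R t s)).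

Definition B22_prec (u v : B22) : B22 := B22_diamond u (B22_beta v).
Definition B22_succ (u v : B22) : B22 := B22_diamond (B22_beta u) v.

Lemma B22_restrictK (u : {malg R[ptree]}) :
  supported in_T22 u -> B22_incl (B22_restrict u) = u.
Proof.
move=> uT; rewrite /B22_restrict linextE /B22_incl linear_sum /=.
rewrite [RHS]monalgE big_seq [RHS]big_seq; apply: eq_bigr => t /uT tT.
rewrite linearZ /= insubT linextU /=; apply/malgP => k.
by rewrite mcoeffZ !mcoeffU mulrnAr mulr1.
Qed.

Lemma B22_betaE (t : T22) : B22_incl (B22_beta << t >>) = pbeta R t.
Proof.
rewrite /B22_beta linextU B22_restrictK //.
by move=> k /(pbeta_T22 (valP t)) /andP[]; exact: in_T22_hat.
Qed.

Lemma B22_diamondE (t s : T22) :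
  B22_incl (B22_diamond << t >> << s >>) = pdiamond R t s.
Proof.
rewrite /B22_diamond bilextU B22_restrictK //.
by apply: pdiamond_T22; exact: valP.
Qed.

End B22.

Section CanonicalMorphism.
Context (R : comNzRingType).

Definition DD_B22_morphism (j : {linear DD R -> B22 R}) : Prop :=
  dendriform_morphism (@DD_prec R) (@DD_succ R) (@B22_prec R) (@B22_succ R) j.

Definition canonical_morphism (j : {linear DD R -> B22 R}) : Prop :=
  [/\ DD_B22_morphism j, j << Ygen >> = << Ytree >> &
      forall j' : {linear DD R -> B22 R},
        DD_B22_morphism j' -> j' << Ygen >> = << Ytree >> -> j' =1 j].

End CanonicalMorphism.

Fixpoint decorate1 (x : btree) : ptree :=
  if x is BNode a b then pnode 1 [:: decorate1 a; decorate1 b] else pleaf.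

Lemma decorate1_hat (x : btree) : in_T22plus_hat (decorate1 x).
Proof.
elim: x => // a /andP[ga la] b /andP[gb lb].
by rewrite /in_T22plus_hat /= ga gb la lb.
Qed.

Lemma decorate0_T22 (x : PBT) : in_T22 (overline (decorate1 x)).
Proof.
by apply: in_T22_overline; [exact: decorate1_hat | case: x => -[]].
Qed.

Definition decorate0 (x : PBT) : T22 := MkT22 (decorate0_T22 x).

(* Main.v *)
Require Import Defs.
From mathcomp Require Import all_boot ssralg finmap monalg.

Import GRing.Theory.
Local Open Scope ring_scope.

(** The subspace of [B22 R] spanned by the binary trees whose root is labeled 0
    is a copy of DD. Indeed a binary tree of DD read with root label 0 has
    exactly two root subtrees, so de-grafting a product [t <> s] where one of
    the factors has root label 1 and the other has root label 0 merely
    replaces one of the two subtrees of the latter, and the grafting that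
    follows again produces a binary root: there are no middle children to
    delete. The replacement is [beta (overline t_n * overline s_1)], and the
    two overlined trees are themselves binary trees with root label 0, or
    the one-node tree.
    Hence the recursions that define [prec] and [succ] in both algebras are
    the same recursion as soon as the two products [*] correspond, and these
    in turn correspond by induction, being sums of [prec] and [succ]
    ([pstar_overline], which rests on [pdiamond_decorate01] and
    [pdiamond_decorate10]). So the linear extension of [decorate0] is a
    dendriform morphism.

    It is the canonical one because DD is generated by [Ygen]: a tree with
    subtrees [a] and [b] is [(a succ Ygen) prec b], where a factor is omitted when
    the subtree is the one-node tree ([DD_generated]). It is injective because
    forgetting the labels gives a linear retraction. *)

(** * Linear extensions *)

Section LinearExtensionTheory.
Context (R : comNzRingType) (K : choiceType).

Lemma linext_unit (u : {malg R[K]}) : linext (fun k => << k >>) u = u.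
Proof.
rewrite linextE [RHS]monalgE; apply: eq_bigr => k _.
by apply/malgP => l; rewrite mcoeffZ !mcoeffU mulrnAr mulr1.
Qed.

Lemma linear_linext (M N : lmodType R) (g : {linear M -> N}) (f : K -> M)
    (u : {malg R[K]}) :
  g (linext f u) = linext (g \o f) u.
Proof.
by rewrite !linextE linear_sum; apply: eq_bigr => k _; rewrite linearZ.
Qed.

Lemma linextK (L : choiceType) (M : lmodType R) (g : L -> M)
    (f : K -> {malg R[L]}) (u : {malg R[K]}) :
  linext g (linext f u) = linext (fun k => linext g (f k)) u.
Proof. exact: linear_linext. Qed.

Lemma linear_malg_ext (M : lmodType R) (f g : {linear {malg R[K]} -> M}) :
  (forall k, f << k >> = g << k >>) -> f =1 g.
Proof.
move=> fg u; rewrite -[u]linext_unit !linear_linext.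
exact: eq_linext.
Qed.

Lemma bilextC (L : choiceType) (M : lmodType R) (f : K -> L -> M)
    (u : {malg R[K]}) (v : {malg R[L]}) :
  bilext f u v = bilext (fun l k => f k l) v u.
Proof.
rewrite /bilext !linextE.
under eq_bigr => k _ do rewrite linextE scaler_sumr.
under [RHS]eq_bigr => l _ do rewrite linextE scaler_sumr.
rewrite exchange_big; apply: eq_bigr => l _; apply: eq_bigr => k _.
by rewrite !scalerA mulrC.
Qed.

(** A map of bases that intertwines two bilinear products on basis vectors
    extends to a morphism. *)
Lemma bilext_morph (L : choiceType) (h : K -> L)
    (f : K -> K -> {malg R[K]}) (g : L -> L -> {malg R[L]}) :
  (forall k l, linext (fun k' => << h k' >>) (f k l) = g (h k) (h l)) ->
  forall u v : {malg R[K]},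
    linext (fun k => << h k >>) (bilext f u v) =
    bilext g (linext (fun k => << h k >>) u) (linext (fun k => << h k >>) v).
Proof.
move=> fg u v; rewrite /bilext !linextK; apply: eq_linext => k.
by rewrite linextU !linextK; apply: eq_linext => l; rewrite linextU fg.
Qed.

End LinearExtensionTheory.

(** * Products of decorated binary trees *)

Section DecoratedProducts.
Context (R : comNzRingType).

Let d0 (x : btree) : ptree := overline (decorate1 x).

Lemma pbeta_overline (x : btree) : pbeta R (d0 x) = << decorate1 x >>.
Proof. by case: x. Qed.

(** The right factor is not de-grafted, since its root is not labeled 0: it is
    multiplied as a whole with the right subtree [b] of the left factor, and
    [a] is left untouched. The hypothesis on [*] is an induction hypothesis
    for [pstar_overline]. *)
Lemma pdiamond_decorate01 (a b y : btree) (w : hatDD R) :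
  pstar R (d0 b) (d0 y) = linext (fun c => << d0 c >>) w ->
  pdiamond R (d0 (BNode a b)) (decorate1 y) =
  linext (fun c => << d0 (BNode a c) >>) w.
Proof.
move=> bw; rewrite /pdiamond /diamond_with.
have -> : overline_last (d0 (BNode a b)) = d0 b by [].
have -> : overline_first (decorate1 y) = d0 y by case: y {bw}.
have -> : behead (degraft (decorate1 y)) = [::] by case: y {bw}.
rewrite bw !linextK; apply: eq_linext => c.
by rewrite linextU pbeta_overline linextU.
Qed.

Lemma pdiamond_decorate10 (x a b : btree) (w : hatDD R) :
  pstar R (d0 x) (d0 a) = linext (fun c => << d0 c >>) w ->
  pdiamond R (decorate1 x) (d0 (BNode a b)) =
  linext (fun c => << d0 (BNode c b) >>) w.
Proof.
move=> xw; rewrite /pdiamond /diamond_with.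
have -> : overline_last (decorate1 x) = d0 x by case: x {xw}.
have -> : overline_first (d0 (BNode a b)) = d0 a by [].
have -> : front (degraft (decorate1 x)) = [::] by case: x {xw}.
rewrite xw !linextK; apply: eq_linext => c.
by rewrite linextU pbeta_overline linextU.
Qed.

(** Both products satisfy the same recursion: the summand [x prec y] lowers the
    left factor to its right subtree, the summand [x succ y] lowers the right
    factor to its left subtree. *)
Lemma pstar_overline (x y : btree) :
  pstar R (d0 x) (d0 y) = linext (fun c => << d0 c >>) (btree_star R x y).
Proof.
elim: x y => [|x1 _ x2 IHx] y.
  by rewrite btree_star_leafl linextU pstar_leafl.
elim: y => [|y1 IHy y2 _].
  by rewrite btree_star_leafr linextU pstar_leafr.
rewrite pstarE // !pbeta_overline !linextU.
rewrite (pdiamond_decorate01 _ _ _ _ (IHx _)) (pdiamond_decorate10 _ _ _ _ IHy).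
rewrite (btree_starE R (bjoin x1 x2) (bjoin y1 y2)) /DD_prec /DD_succ !bilextU.
rewrite /DD_incl !linearD /= addrC; congr (_ + _).
  rewrite /Gamma /bilext linextU !linextK; apply: eq_linext => c.
  by rewrite !linextU.
rewrite /Gamma /bilext !linextK; apply: eq_linext => c.
by rewrite !linextU.
Qed.

End DecoratedProducts.

(** * The morphism decorating binary trees *)

Section Decoration.
Context (R : comNzRingType).

Definition decoration : {linear DD R -> B22 R} :=
  linext (fun x : PBT => << decorate0 x >> : B22 R).

Lemma decorationU (x : PBT) : decoration << x >> = << decorate0 x >>.
Proof. exact: linextU. Qed.

Lemma decorate1_T22 (x : PBT) : in_T22 (decorate1 x).
Proof. by apply: in_T22_hat; [exact: decorate1_hat | case: x => -[]]. Qed.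

Lemma B22_restrictU (t : ptree) (tT : in_T22 t) :
  B22_restrict << t >> = << MkT22 tT >> :> B22 R.
Proof. by rewrite /B22_restrict linextU insubT. Qed.

Lemma B22_beta_decorate0 (x : PBT) :
  B22_beta << decorate0 x >> = << MkT22 (decorate1_T22 x) >> :> B22 R.
Proof.
rewrite /B22_beta linextU pbeta_overline.
exact: (B22_restrictU _ (decorate1_T22 x)).
Qed.

(** [beta] being linear, [prec] and [succ] are determined by their values on
    basis trees. *)
Lemma B22_precE (u v : B22 R) :
  B22_prec u v = bilext (fun t s => B22_prec << t >> << s >>) u v.
Proof.
rewrite /B22_prec /B22_diamond /bilext /B22_beta.
apply: eq_linext => t; rewrite linextK; apply: eq_linext => s.
by rewrite !linextU.
Qed.

Lemma B22_succE (u v : B22 R) :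
  B22_succ u v = bilext (fun t s => B22_succ << t >> << s >>) u v.
Proof.
rewrite /B22_succ /B22_diamond /bilext /B22_beta linextK.
apply: eq_linext => t; rewrite linextU.
(* On the left, the sum over [beta t] is outside the sum over [v]. *)
rewrite -/(bilext _ _ v) bilextC /bilext; apply: eq_linext => s.
by apply: eq_linext => t'; rewrite linextU.
Qed.

Lemma decoration_prec (x y : PBT) :
  decoration (DD_prec << x >> << y >>) =
  B22_prec << decorate0 x >> << decorate0 y >>.
Proof.
rewrite /B22_prec B22_beta_decorate0 /B22_diamond /DD_prec !bilextU.
case: x => -[|a b] // ? /=.
rewrite (pdiamond_decorate01 _ _ _ _ _ (pstar_overline _ _ _)).
rewrite /Gamma /bilext linextU /B22_restrict !linextK; apply: eq_linext => c.
by rewrite !linextU (insubT in_T22 (decorate0_T22 (bjoin a c))).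
Qed.

Lemma decoration_succ (x y : PBT) :
  decoration (DD_succ << x >> << y >>) =
  B22_succ << decorate0 x >> << decorate0 y >>.
Proof.
rewrite /B22_succ B22_beta_decorate0 /B22_diamond /DD_succ !bilextU.
case: y => -[|a b] // ? /=.
rewrite (pdiamond_decorate10 _ _ _ _ _ (pstar_overline _ _ _)).
rewrite /Gamma /bilext /B22_restrict !linextK; apply: eq_linext => c.
by rewrite !linextU (insubT in_T22 (decorate0_T22 (bjoin c b))).
Qed.

Lemma decoration_morphism : DD_B22_morphism decoration.
Proof.
split=> u v.
  rewrite B22_precE; apply: bilext_morph => x y.
  by rewrite -decoration_prec /DD_prec bilextU.
rewrite B22_succE; apply: bilext_morph => x y.
by rewrite -decoration_succ /DD_succ bilextU.
Qed.

(** A common left inverse of [decorate0] and [decorate1]. *)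
Fixpoint undecorate (t : ptree) : btree :=
  if t is GenTree.Node _ [:: a; b] then BNode (undecorate a) (undecorate b)
  else BLeaf.

Lemma decorate1K : cancel decorate1 undecorate.
Proof. by elim=> //= a -> b ->. Qed.

Lemma decorate0K (x : PBT) : undecorate (decorate0 x) = x.
Proof. by case: x => -[|a b] //= ?; rewrite !decorate1K. Qed.

Lemma decoration_inj : injective decoration.
Proof.
pose r : B22 R -> DD R :=
  linext (fun t : T22 => << insubd Ygen (undecorate t) >>).
apply: (can_inj (g := r)) => u; rewrite /r /decoration /= linextK -[RHS]linext_unit.
by apply: eq_linext => x; rewrite linextU decorate0K valKd.
Qed.

End Decoration.

(** * DD is generated by one tree *)

Section Generation.
Context (R : comNzRingType).

Lemma bjoin_prec (a : btree) (y : PBT) :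
  DD_prec << bjoin a BLeaf >> << y >> = << bjoin a y >> :> DD R.
Proof. by rewrite /DD_prec bilextU btree_star_leafl /Gamma bilextU. Qed.

Lemma bjoin_succ (x : PBT) (b : btree) :
  DD_succ << x >> << bjoin BLeaf b >> = << bjoin x b >> :> DD R.
Proof. by rewrite /DD_succ bilextU btree_star_leafr /Gamma bilextU. Qed.

(** By induction on trees: [a succ Ygen] has subtrees [a] and the one-node
    tree, and multiplying it by [prec b] on the right puts [b] in place of the
    latter. A one-node subtree, not being an element of DD, is obtained by
    omitting the corresponding factor. *)
Lemma DD_generated (P : DD R -> Prop) :
  P << Ygen >> ->
  (forall u v, P u -> P v -> P (DD_prec u v)) ->
  (forall u v, P u -> P v -> P (DD_succ u v)) ->
  forall x : PBT, P << x >>.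
Proof.
move=> PY Pprec Psucc [x xT].
elim: x xT => [//|a IHa b IHb] xT.
rewrite (_ : MkPBT xT = bjoin a b); last exact: val_inj.
have Pa : P << bjoin a BLeaf >>.
  case: a IHa {xT} => [|a1 a2] IHa; first exact: PY.
  rewrite -(bjoin_succ (bjoin a1 a2)).
  by apply: Psucc; [exact: (IHa isT) | exact: PY].
case: b IHb {xT} => [|b1 b2] IHb; first exact: Pa.
rewrite -(bjoin_prec _ (bjoin b1 b2)).
by apply: Pprec; [exact: Pa | exact: (IHb isT)].
Qed.

Lemma dendriform_morphism_ext (E : lmodType R) (pE sE : E -> E -> E)
    (f g : {linear DD R -> E}) :
  dendriform_morphism (@DD_prec R) (@DD_succ R) pE sE f ->
  dendriform_morphism (@DD_prec R) (@DD_succ R) pE sE g ->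
  f << Ygen >> = g << Ygen >> -> f =1 g.
Proof.
move=> [fp fs] [gp gs] fgY; apply: linear_malg_ext.
apply: (DD_generated (fun u => f u = g u)) => // u v fu fv.
  by rewrite fp gp fu fv.
by rewrite fs gs fu fv.
Qed.

End Generation.

Theorem proposition5p5 (R : comNzRingType) :
  exists j : {linear DD R -> B22 R},
    [/\ canonical_morphism j,
        forall x : PBT, j << x >> = << decorate0 x >>
      & injective j].
Proof.
exists (decoration R).
have jY : << decorate0 Ygen >> = << Ytree >> :> B22 R.
  by congr << _ >>; exact: val_inj.
split; [split | exact: decorationU | exact: decoration_inj].
- exact: decoration_morphism.
- by rewrite decorationU.
- move=> j' j'M j'Y; apply: dendriform_morphism_ext j'M _ _.
    exact: decoration_morphism.
  by rewrite j'Y decorationU.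
Qed.
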